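(* Let $X_1,X_2,\dots$ be independent real random variables with $E[X_j]=0$, $0<\sigma_j^2:=E[X_j^2]$ and $\xi_j:=E|X_j|^3<\infty$ for all $j\ge1$. Let $\lambda>0$ and let $N\sim\mathrm{Poisson}(\lambda)$ be independent of the sequence $(X_j)_{j\ge1}$. For $n\ge1$ put $\hat\sigma_n^2:=\frac1n\sum_{j=1}^n\sigma_j^2$ (with $\hat\sigma_n>0$) and $\hat\xi_n:=\frac1n\sum_{j=1}^n\xi_j$. Assume that the limit $\hat\sigma^2:=\lim_{n\to\infty}\frac1n\sum_{j=1}^n\sigma_j^2$ exists and satisfies $0<\hat\sigma^2<\infty$ (with $\hat\sigma>0$). Put $W:=\lambda^{-1/2}\sum_{j=1}^NX_j$. Then $$d_{\mathcal W}\bigl(\mathcal L(W),N(0,\hat\sigma^2)\bigr)\le\hat\sigma\sqrt{\frac2\pi}\frac1{\sqrt\lambda}+\frac{C_{\mathcal W}}{\sqrt\lambda}E\Bigl[\frac{\hat\xi_N}{\hat\sigma_N^2}\Bigr]+\frac{2e^{-\lambda}}{\sqrt\lambda}\sum_{n=1}^\infty\frac{\lambda^n}{\sqrt n\,(n-1)!}\min\Bigl(\hat\sigma_n\Bigl|1-\frac{\hat\sigma^2}{\hat\sigma_n^2}\Bigr|,\hat\sigma\Bigl|1-\frac{\hat\sigma_n^2}{\hat\sigma^2}\Bigr|\Bigr),$$ where $\hat\xi_N/\hat\sigma_N^2$ is read as $0$ on the event $\{N=0\}$.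
   Context: $\mathcal L(Y)$ denotes the distribution of a random variable $Y$; an empty sum is $0$. $d_{\mathcal W}(\mu,\nu):=\sup_h|\int h\,d\mu-\int h\,d\nu|$, the supremum over all $1$-Lipschitz $h:\mathbb R\to\mathbb R$, is the Wasserstein distance of probability measures on $\mathbb R$ with finite first moment. $C_{\mathcal W}$ is a finite absolute constant in the Wasserstein version of the Berry-Esseen theorem, i.e. a constant such that for all $n\ge1$ and all independent random variables $Y_1,\dots,Y_n$ with $E[Y_j]=0$, $E[Y_j^2]>0$, $E|Y_j|^3<\infty$, writing $B_n^2=\sum_{j=1}^nE[Y_j^2]$, one has $d_{\mathcal W}\bigl(\mathcal L(B_n^{-1}\sum_{j=1}^nY_j),N(0,1)\bigr)\le C_{\mathcal W}B_n^{-3}\sum_{j=1}^nE|Y_j|^3$. The expectation on the right-hand side is of a nonnegative random variable and may be $+\infty$. *)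

(* Defs.v *)
From HB Require Import structures.
From mathcomp Require Import all_boot all_order all_algebra.
From mathcomp Require Import finmap.
From mathcomp Require Import all_classical all_reals all_analysis.
From mathcomp Require Import measurable_realfun.

Set Implicit Arguments.
Unset Strict Implicit.
Unset Printing Implicit Defensive.

Import Order.TTheory GRing.Theory Num.Theory.
Import numFieldNormedType.Exports.

Local Open Scope classical_set_scope.
Local Open Scope ring_scope.

Definition mutually_independent d (T : measurableType d) (R : realType)
    (P : probability T R) (I : choiceType) (X : I -> {RV P >-> R}) : Prop :=
  forall (J : {fset I}) (A : I -> set R), (forall j, measurable (A j)) ->
    P (\bigcap_(j in [set` J]) (X j @^-1` A j)) =
    (\prod_(j <- J) P (X j @^-1` A j))%E.

Definition sigma_algebra_seq d (T : measurableType d) (R : realType)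
    (P : probability T R) (X : nat -> {RV P >-> R}) : set (set T) :=
  <<s \bigcup_j preimage_set_system setT (X j) measurable >>.

Definition independent_of_seq d (T : measurableType d) d' (T' : measurableType d')
    (R : realType) (P : probability T R)
    (N : {RV P >-> T'}) (X : nat -> {RV P >-> R}) : Prop :=
  forall (A : set T) (B : set T'), sigma_algebra_seq X A -> measurable B ->
    P (A `&` N @^-1` B) = (P A * P (N @^-1` B))%E.

(* [normal_prob] lives on [measurableTypeR R], whereas the law of a real random
   variable lives on [R]; the measurable sets are the same but the structures
   carry different displays, hence this retyping.  The parameter [s] is the
   standard deviation. *)
Definition normal_law (R : realType) (m s : R) : set R -> \bar R :=
  normal_prob m s.

Section normal_law.
Context (R : realType) (m s : R).

Let normal_law0 : normal_law m s set0 = 0%E.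
Proof. exact: (@measure0 _ _ _ (normal_prob m s)). Qed.

Let normal_law_ge0 A : (0 <= normal_law m s A)%E.
Proof. exact: (@measure_ge0 _ _ _ (normal_prob m s)). Qed.

Let normal_law_sigma_additive : semi_sigma_additive (normal_law m s).
Proof. exact: (@measure_semi_sigma_additive _ _ _ (normal_prob m s)). Qed.

HB.instance Definition _ := isMeasure.Build _ _ _ (normal_law m s)
  normal_law0 normal_law_ge0 normal_law_sigma_additive.

Let normal_law_setT : normal_law m s setT = 1%E.
Proof. exact: (@probability_setT _ _ _ (normal_prob m s)). Qed.

HB.instance Definition _ :=
  @Measure_isProbability.Build _ _ R (normal_law m s) normal_law_setT.

End normal_law.

(* Meant for laws with a finite first moment, for which both integrals of a
   1-Lipschitz function are finite. *)
Definition wasserstein (R : realType) (mu nu : probability R R) : \bar R :=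
  ereal_sup [set `| \int[mu]_x (h x)%:E - \int[nu]_x (h x)%:E |%E
            | h in [set h : R -> R | 1.-lipschitz h]].

Section moments.
Context d (T : measurableType d) (R : realType) (P : probability T R).

Definition second_moment (X : {RV P >-> R}) : \bar R :=
  'E_P[(fun w => X w ^+ 2)%R]%E.

Definition third_abs_moment (X : {RV P >-> R}) : \bar R :=
  'E_P[(fun w => `|X w| ^+ 3)%R]%E.

(* Indices start at 0: [X j] is the (j+1)-st variable of the sequence. *)
Definition avg_second_moment (X : nat -> {RV P >-> R}) (n : nat) : R :=
  n%:R^-1 * \sum_(j < n) fine (second_moment (X j)).

Definition avg_third_abs_moment (X : nat -> {RV P >-> R}) (n : nat) : R :=
  n%:R^-1 * \sum_(j < n) fine (third_abs_moment (X j)).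

Definition scaled_random_sum (c : R) (N : {RV P >-> nat})
    (X : nat -> {RV P >-> R}) (w : T) : R :=
  c * \sum_(j < N w) X j w.

Lemma measurable_scaled_random_sum c N X :
  measurable_fun setT (scaled_random_sum c N X).
Proof.
apply: measurable_funM => // _ A mA; rewrite setTI.
have -> : (fun w => \sum_(j < N w) X j w) @^-1` A =
    \bigcup_n (N @^-1` [set n] `&` (fun w => \sum_(j < n) X j w) @^-1` A).
  apply/seteqP; split => [w Aw|w [n _ [/= <-]]] //.
  by exists (N w).
apply: bigcup_measurable => n _; apply: measurableI.
  exact: measurable_funPTI.
have /(_ measurableT A mA) : measurable_fun setT (fun w => \sum_(j < n) X j w).
  by apply: measurable_sum => j.
by rewrite setTI.
Qed.

HB.instance Definition _ c N X := isMeasurableFun.Build _ _ _ _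
  (scaled_random_sum c N X) (measurable_scaled_random_sum c N X).

Definition normalized_sum n (Y : 'I_n -> {RV P >-> R}) (b : R) (w : T) : R :=
  b^-1 * \sum_(j < n) Y j w.

Lemma measurable_normalized_sum n (Y : 'I_n -> {RV P >-> R}) b :
  measurable_fun setT (normalized_sum Y b).
Proof. by apply: measurable_funM => //; apply: measurable_sum. Qed.

HB.instance Definition _ n (Y : 'I_n -> {RV P >-> R}) b :=
  isMeasurableFun.Build _ _ _ _
  (normalized_sum Y b) (measurable_normalized_sum Y b).

End moments.

Definition wasserstein_berry_esseen_constant (R : realType) (C : R) : Prop :=
  forall d (T : measurableType d) (P : probability T R) (n : nat)
    (Y : 'I_n -> {RV P >-> R}), (0 < n)%N ->
    mutually_independent Y ->
    (forall j, 'E_P[Y j] = 0)%E ->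
    (forall j, 0 < second_moment (Y j))%E ->
    (forall j, third_abs_moment (Y j) < +oo)%E ->
    let B := Num.sqrt (\sum_(j < n) fine (second_moment (Y j))) in
    (wasserstein (distribution P (normalized_sum Y B)) (normal_law 0 1) <=
     (C * B ^- 3 * \sum_(j < n) fine (third_abs_moment (Y j)))%:E)%E.

(* Main.v *)
Require Import Defs.
From HB Require Import structures.
From mathcomp Require Import all_boot all_order all_algebra.
From mathcomp Require Import finmap.
From mathcomp Require Import all_classical all_reals all_analysis.
From mathcomp Require Import measurable_realfun ring lra.

Set Implicit Arguments.
Unset Strict Implicit.
Unset Printing Implicit Defensive.

Import Order.TTheory GRing.Theory Num.Theory.
Import numFieldNormedType.Exports.

Local Open Scope classical_set_scope.
Local Open Scope ring_scope.

(** Fix a 1-Lipschitz test function h and let Z be standard normal.  Since N is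
independent of the sequence X, the law of W is the mixture, with the Poisson
weights p_n, of the laws of W_n = (X_0 + ... + X_(n-1)) / sqrt lambda.  After
subtraction of the constant E h(sigma Z), the triangle inequality for a series
([abse_integral_random_sum]) reduces the theorem to a bound, for each n, of
|E h(W_n) - E h(sigma Z)|, which is then averaged over n.

For n >= 1 two comparisons are made ([conditional_wasserstein_bound]).
- W_n has standard deviation t_n = sqrt (n / lambda) * sigma_hat_n, so the
  Berry-Esseen hypothesis applied to its standardization, rescaled by t_n,
  bounds |E h(W_n) - E h(t_n Z)| by the n-th term of the second summand
  ([berry_esseen_partial_sum]).
- Coupling the two normal laws through the same Z gives
  |E h(t_n Z) - E h(sigma Z)| <= |t_n - sigma| E|Z|, where E|Z| = sqrt (2 / pi)
  ([normal_law_dilation_dist], [integral_normal_law_abs]).  Moreover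
  |t_n - sigma| <= sqrt (n / lambda) |sigma_hat_n - sigma|
                   + sigma |sqrt (n / lambda) - 1|,
  and |a - b| <= min (a |1 - b^2 / a^2|, b |1 - a^2 / b^2|) ([dist_le_min]).
  Together with sqrt (2 / pi) <= 2 this produces the third summand and, as the
  part that remains, sigma sqrt (2 / pi) |sqrt (n / lambda) - 1|.
For n = 0 the law of W_0 is a point mass at 0 = 0 * Z, so the coupling bound
alone suffices.

The average of |sqrt (N / lambda) - 1| is at most 1 / sqrt lambda because
|sqrt x - 1| <= |x - 1| and the variance of N is lambda
([poisson_sqrt_deviation]); this is the first summand.

Exchanging expectation and mixture needs h(W) to be integrable.  This is where
the convergence of the averaged variances enters: it bounds them, so that
E|W_n| grows at most linearly in n ([integrable_poisson_sum]). *)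

(** * Integrals against normal laws *)

Section normal_law_integrals.
Context {R : realType}.
Local Open Scope ereal_scope.

(** The Radon-Nikodym derivative of the normal probability agrees almost
everywhere with its density, as both have the same integral over every
measurable set. *)
Lemma ge0_integral_normal_prob (s : R) (f : measurableTypeR R -> R) :
  measurable_fun setT f -> (forall x, 0 <= f x)%R ->
  \int[normal_prob 0 s]_x (f x)%:E =
  \int[lebesgue_measure]_x (f x * normal_pdf 0 s x)%:E.
Proof.
move=> mf f0; have dom := normal_prob_dominates 0 s.
have mg := measurable_int _ (Radon_Nikodym_SigmaFinite.f_integrable dom).
have mpdf := measurable_int _ (integrable_normal_pdf 0 s).
have mEf : measurable_fun setT (EFin \o f) by exact/measurable_EFinP.
rewrite -(Radon_Nikodym_SigmaFinite.change_of_variables dom)//.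
under [RHS]eq_integral do rewrite EFinM.
apply: ae_eq_integral => //.
- exact: emeasurable_funM.
- exact: emeasurable_funM.
- apply: ae_eqe_mul2l; apply: integral_ae_eq => //.
  + exact: Radon_Nikodym_SigmaFinite.f_integrable.
  + move=> E _ mE.
    by rewrite -(Radon_Nikodym_SigmaFinite.f_integral dom).
Qed.

(** [normal_law] is the image of [normal_prob] under the identity, seen as a map
between the two measurable structures on the reals. *)
Lemma ge0_integral_normal_law (s : R) (f : R -> R) :
  continuous f -> (forall x, 0 <= f x)%R ->
  \int[normal_law 0 s]_x (f x)%:E =
  \int[lebesgue_measure]_x (f x * normal_pdf 0 s x)%:E.
Proof.
move=> cf f0.
have mf : measurable_fun setT f by exact: continuous_measurable_fun.
transitivity (\int[pushforward (normal_prob 0 s)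
    (idfun : measurableTypeR R -> R)]_x (f x)%:E).
  apply: eq_measure_integral => [_ A mA|mid A mA _].
    by rewrite setTI.
  by [].
rewrite ge0_integral_pushforward//=.
- by rewrite ge0_integral_normal_prob.
- by move=> _ A mA; rewrite setTI.
- exact/measurable_EFinP.
- by move=> x _; rewrite lee_fin.
Qed.

Lemma normal_pdf_scale (s x : R) : (0 < s)%R ->
  (normal_pdf 0 s (s * x) * s = normal_pdf 0 1 x)%R.
Proof.
move=> s0; rewrite !normal_pdfE ?gt_eqF// /normal_peak /normal_fun !subr0.
rewrite mulrAC.
congr (_ * expR _)%R; last by field; rewrite gt_eqF.
rewrite expr1n mul1r -mulrnAr sqrtrM ?sqr_ge0// sqrtr_sqr gtr0_norm//.
by rewrite invfM mulrAC mulVf ?gt_eqF// mul1r.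
Qed.

(** Restricting to continuous functions makes this a substitution in an integral
against Lebesgue measure; Lipschitz test functions are continuous. *)
Lemma ge0_integral_normal_law_scale (s : R) (f : R -> R) : (0 < s)%R ->
  continuous f -> (forall x, 0 <= f x)%R ->
  \int[normal_law 0 s]_x (f x)%:E = \int[normal_law 0 1]_x (f (s * x)%R)%:E.
Proof.
move=> s0 cf f0.
have cs : continuous ( *%R s).
  by move=> x; apply: cvgM; [exact: cvg_cst|exact: cvg_id].
have ds : ( *%R s)^`()%classic = cst s.
  apply/funext => x.
  by rewrite derive1E deriveM// derive_id derive_cst scaler0 addr0 scaler1.
rewrite !ge0_integral_normal_law//; last first.
  by move=> x; apply: continuous_comp; [exact: cs|exact: cf].
rewrite (@increasing_ge0_integration_by_substitutionT _ ( *%R s)).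
- apply: eq_integral => x _; congr EFin.
  by rewrite ds !fctE -mulrA normal_pdf_scale.
- by move=> x y xy; rewrite ltr_pM2l.
- by rewrite ds => ?; exact: cvg_cst.
- by rewrite ds; exact: is_cvg_cst.
- by rewrite ds; exact: is_cvg_cst.
- by move=> x; apply: derivableM.
- apply: gt0_cvgMrNy => //.
- apply: gt0_cvgMry => //.
- move=> x; apply: cvgM; [exact: cf|].
  by apply: continuous_normal_pdf; rewrite gt_eqF.
- by move=> x; rewrite mulr_ge0// normal_pdf_ge0.
Qed.

Lemma integral_normal_law_scale (s : R) (f : R -> R) : (0 < s)%R ->
  continuous f ->
  \int[normal_law 0 s]_x (f x)%:E = \int[normal_law 0 1]_x (f (s * x)%R)%:E.
Proof.
move=> s0 cf.
have posE (g : R -> R) : continuous g ->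
    \int[normal_law 0 s]_x (fun y => (g y)%:E)^\+ x =
    \int[normal_law 0 1]_x (fun y => (g (s * y)%R)%:E)^\+ x.
  move=> cg; pose g' x := Num.max (g x) 0%R.
  rewrite (eq_integral (fun x => (g' x)%:E)); last first.
    by move=> x _; rewrite /g' EFin_max funeposE.
  rewrite ge0_integral_normal_law_scale; [|exact: s0| |]; first last.
  - by move=> x; rewrite /g' le_max lexx orbT.
  - move=> x; apply: (@continuous_max _ _ g (cst 0%R)); first exact: cg.
    exact: cst_continuous.
  by apply: eq_integral => x _; rewrite /g' EFin_max funeposE.
have negE (a : R) (g : R -> R) :
    \int[normal_law 0 a]_x (fun y => (g y)%:E)^\- x =
    \int[normal_law 0 a]_x (fun y => (- g y)%:E)^\+ x.
  by apply: eq_integral => x _; rewrite funenegE funeposE.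
have cNf : continuous (fun x => - f x)%R by move=> x; apply: cvgN; exact: cf.
rewrite integralE (posE _ cf) negE (posE _ cNf) [RHS]integralE.
by rewrite (negE 1%R (fun y => f (s * y)%R)).
Qed.

(** The function x phi(x) is the derivative of - phi, where phi is the standard
normal density, so E|Z| = 2 phi(0). *)
Lemma integral_normal_law_abs :
  \int[normal_law 0 1]_x `|x|%:E = (Num.sqrt (2 / pi) : R)%:E.
Proof.
rewrite (@ge0_integral_normal_law _ (fun x => `|x|)%R)//; last first.
  exact: norm_continuous.
have cp : continuous (normal_pdf 0 1 : R -> R).
  by apply: continuous_normal_pdf; rewrite gt_eqF.
rewrite ge0_symfun_integralT; last 3 first.
- by move=> x; rewrite mulr_ge0// normal_pdf_ge0.
- by move=> x; apply: cvgM; [exact: norm_continuous|exact: cp].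
- move=> x /=; rewrite normrN !normal_pdfE ?gt_eqF// /normal_fun.
  by rewrite !subr0 sqrrN.
rewrite -set_itvcy.
have dp (x : R) : is_derive x 1%R (- (normal_pdf 0 1 : R -> R))%R
    (x * normal_pdf 0 1 x)%R.
  rewrite normal_pdfE ?gt_eqF//.
  have dq : is_derive x 1%R
      (fun y : R => - (y - 0) ^+ 2 / (1 ^+ 2 *+ 2))%R (- x)%R.
    apply: is_derive_eq.
    by rewrite scaler0 /GRing.scale/=; field.
  have de := is_derive1_comp (is_derive_expR _) dq.
  apply: is_derive_eq.
  by rewrite /normal_fun /GRing.scale/=; ring.
rewrite (@ge0_continuous_FTC2y _ _ (- (normal_pdf 0 1 : R -> R))%R 0%R 0%R).
- rewrite sub0e -EFinN -EFinM; congr EFin; rewrite fctE opprK.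
  rewrite normal_pdfE ?gt_eqF// /normal_peak /normal_fun subrr expr0n/=.
  rewrite oppr0 mul0r expR0 mulr1 expr1n mul1r -(mulr_natl pi).
  have pi_neq0 : pi != 0%R :> R by rewrite gt_eqF ?pi_gt0.
  have -> : (2 / pi = 2 ^+ 2 / (2 * pi) :> R)%R.
    by move: pi_neq0; move: (pi : R) => p p0; field.
  rewrite [RHS]sqrtrM ?sqr_ge0// sqrtr_sqr ger0_norm//.
  by rewrite sqrtrV// mulr_ge0// pi_ge0.
- by move=> x x0; rewrite mulr_ge0// normal_pdf_ge0.
- apply: continuous_subspaceT => x.
  by apply: cvgM; [exact: norm_continuous|exact: cp].
- have nf0 : (normal_fun 0 1 : R -> R) @ +oo%R --> 0%R.
    have -> : normal_fun 0 1 =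
        (fun y : R => expR (- y)) \o (fun y : R => y ^+ 2 / 2)%R.
      by apply/funext => y; rewrite /normal_fun/= subr0 expr1n mulNr.
    apply: cvg_comp; last exact: cvgr_expR.
    by apply: gt0_cvgMly; [rewrite invr_gt0|exact: cvgr_expr2].
  rewrite -[X in _ --> X]oppr0; apply: cvgN.
  rewrite -[X in _ --> X](mulr0 (normal_peak 1)) normal_pdfE ?gt_eqF//.
  by apply: cvgM; [exact: cvg_cst|exact: nf0].
- by move=> x _; have [] := dp x.
- by apply: cvg_at_right_filter; apply: cvgN; exact: cp.
- move=> x; rewrite in_itv/= andbT => x0; rewrite derive1E.
  by have [_ ->] := dp x; rewrite gtr0_norm.
Qed.
End normal_law_integrals.

(** * Lipschitz test functions and the Wasserstein distance *)

Section lipschitz_test_functions.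
Context {R : realType}.
Implicit Types (h : R -> R) (mu nu : probability R R).

Lemma lipschitz1P h :
  1.-lipschitz h <-> forall x y, `|h x - h y| <= `|x - y|.
Proof.
split=> [hl x y|hl [x y] _ /=]; last by rewrite mul1r.
by have := hl (x, y); rewrite /= mul1r; apply.
Qed.

Lemma lipschitz1_continuous h : 1.-lipschitz h -> continuous h.
Proof.
move=> /lipschitz1P hl x; apply/cvgrPdist_le => e e0.
near=> t; apply: le_trans (hl _ _) _; near: t.
exact: cvgr_dist_le.
Unshelve. all: by end_near. Qed.

Lemma lipschitz1_scale h (c : R) : 0 < c -> 1.-lipschitz h ->
  1.-lipschitz (fun x => c^-1 * h (c * x)).
Proof.
move=> c0 /lipschitz1P hl; apply/lipschitz1P => x y.
rewrite -mulrBr normrM gtr0_norm ?invr_gt0// ler_pdivrMl//.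
by rewrite (le_trans (hl _ _))// -mulrBr normrM gtr0_norm.
Qed.

Lemma lipschitz1_integrable d (T : measurableType d) (P : probability T R)
    (Y : T -> R) h : measurable_fun setT Y ->
  P.-integrable setT (EFin \o Y) -> 1.-lipschitz h ->
  P.-integrable setT (fun w => (h (Y w))%:E).
Proof.
move=> mY iY hl.
have mh : measurable_fun setT h.
  by apply: continuous_measurable_fun; exact: lipschitz1_continuous.
have /lipschitz1P hd := hl.
apply: (@le_integrable _ _ _ _ _ measurableT _
  (fun w => (`|h 0| + `|Y w|)%:E)).
- apply/measurable_EFinP; exact: measurableT_comp.
- move=> w _ /=; rewrite lee_fin [leRHS]ger0_norm ?addr_ge0//.
  rewrite -lerBlDl (le_trans (lerB_dist _ _))//.
  by rewrite (le_trans (hd _ _))// subr0.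
- apply: (@integrableD _ _ _ _ _ measurableT (EFin \o cst `|h 0|)
    (fun w => `|Y w|%:E)).
    exact: finite_measure_integrable_cst.
  exact: (integrable_norm iY).
Qed.

Lemma le_wasserstein mu nu h : 1.-lipschitz h ->
  (`| \int[mu]_x (h x)%:E - \int[nu]_x (h x)%:E | <= wasserstein mu nu)%E.
Proof. by move=> hl; apply: ereal_sup_ubound; exists h. Qed.

(** The Wasserstein distance is homogeneous under dilations: h(c x) / c is again
1-Lipschitz. *)
Lemma le_wasserstein_scale mu nu h (c : R) : 0 < c -> 1.-lipschitz h ->
  mu.-integrable setT (EFin \o id) -> nu.-integrable setT (EFin \o id) ->
  (`| \int[mu]_x (h (c * x)%R)%:E - \int[nu]_x (h (c * x)%R)%:E |
     <= c%:E * wasserstein mu nu)%E.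
Proof.
move=> c0 hl imu inu; have hcl := lipschitz1_scale c0 hl.
have := le_wasserstein mu nu hcl.
have E (m : probability R R) : m.-integrable setT (EFin \o id) ->
    (\int[m]_x (h (c * x)%R)%:E = c%:E * \int[m]_x (c^-1 * h (c * x))%:E)%E.
  move=> im; rewrite -integralZl//=; last exact: lipschitz1_integrable hcl.
  by apply: eq_integral => x _; rewrite -EFinM mulVKf ?gt_eqF.
rewrite (E _ imu) (E _ inu) -muleBr//; last first.
  rewrite fin_num_adde_defr// integrable_fin_num//.
  exact: lipschitz1_integrable hcl.
rewrite abseM (@gee0_abs _ c%:E) ?lee_fin ?(ltW c0)//.
by move=> hw; apply: lee_wpmul2l => //; rewrite lee_fin ltW.
Qed.

Lemma integrable_normal_law_id :
  (@normal_law R 0 1).-integrable setT (EFin \o id).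
Proof.
apply/integrableP; split; first exact/measurable_EFinP.
by rewrite integral_normal_law_abs ltry.
Qed.

(** The laws of a Z and b Z are coupled through the same Z.  The factors a and b
may vanish or be negative; a = 0 is the point mass at 0. *)
Lemma normal_law_dilation_dist h (a b : R) : 1.-lipschitz h ->
  (`| \int[normal_law 0 1]_x (h (a * x)%R)%:E
      - \int[normal_law 0 1]_x (h (b * x)%R)%:E |
     <= (`|a - b| * Num.sqrt (2 / pi))%:E)%E.
Proof.
move=> hl; have /lipschitz1P hd := hl.
have mh : measurable_fun setT h.
  by apply: continuous_measurable_fun; exact: lipschitz1_continuous.
have ii (c : R) : (normal_law 0 1).-integrable setT (fun x => (h (c * x)%R)%:E).
  apply: (@lipschitz1_integrable _ _ (normal_law 0 1) (fun x => c * x)) => //.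
- exact: measurable_funM.
- exact: (integrableZl measurableT c integrable_normal_law_id).
rewrite -integralB_EFin; [|by []|exact: ii|exact: ii].
apply: le_trans (le_abse_integral _ _ _) _ => //.
  apply/measurable_EFinP; apply: measurable_funB.
    by apply: measurableT_comp => //; exact: measurable_funM.
  by apply: measurableT_comp => //; exact: measurable_funM.
rewrite EFinM -integral_normal_law_abs -ge0_integralZl//=; last first.
  exact/measurable_EFinP.
apply: ge0_le_integral => //=.
- apply/measurable_EFinP; apply: measurableT_comp => //; apply: measurable_funB.
    by apply: measurableT_comp => //; exact: measurable_funM.
  by apply: measurableT_comp => //; exact: measurable_funM.
- by apply/measurable_EFinP; exact: measurable_funM.
- by move=> x _; rewrite -EFinM lee_fin (le_trans (hd _ _))// -mulrBl normrM.
Qed.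

End lipschitz_test_functions.

(** * Integration over an independent event *)

Section independent_event.
Local Open Scope ereal_scope.
Context d (T : measurableType d) (R : realType).

Lemma ge0_integral_mrestr (mu : {measure set T -> \bar R}) (A : set T)
    (mA : measurable A) (f : T -> \bar R) :
  measurable_fun setT f -> (forall x, 0 <= f x) ->
  \int[mrestr mu mA]_x f x = \int[mu]_(x in A) f x.
Proof.
move=> mf f0; have mAC := measurableC mA.
rewrite -(setUv A) ge0_integral_setU//=; last 2 first.
- by rewrite setUv.
- exact/disj_setPCl.
rewrite [X in _ + X]null_set_integral ?adde0//; last 2 first.
- exact: measurable_funTS.
- by rewrite /= /mrestr setICl measure0.
apply: eq_measure_integral => B mB BA.
by rewrite /= /mrestr (setIidl BA).
Qed.

(** The joint law B |-> P (Y in B, A) is the multiple by P A of the law of Y. *)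
Lemma ge0_integral_indep (P : probability T R) (A : set T) (Y : T -> R)
    (f : R -> \bar R) :
  measurable A -> measurable_fun setT Y -> measurable_fun setT f ->
  (forall x, 0 <= f x) ->
  (forall B, measurable B -> P (Y @^-1` B `&` A) = P (Y @^-1` B) * P A) ->
  \int[P]_(w in A) f (Y w) = P A * \int[P]_w f (Y w).
Proof.
move=> mA mY mf f0 YA.
have mfY : measurable_fun setT (f \o Y) by exact: measurableT_comp.
pose p : {nonneg R} := NngNum (fine_ge0 (measure_ge0 P A)).
have pE : p%:num%:E = P A by rewrite /= fineK// fin_num_measure.
rewrite -(ge0_integral_mrestr P mA mfY); last by move=> x; exact: f0.
have -> : \int[mrestr P mA]_x (f \o Y) x =
    \int[pushforward (mrestr P mA) Y]_y f y.
  by rewrite ge0_integral_pushforward.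
have -> : \int[P]_x (f \o Y) x = \int[pushforward P Y]_y f y.
  by rewrite ge0_integral_pushforward.
rewrite -pE -ge0_integral_mscale//.
apply: eq_measure_integral => //= B mB _.
rewrite /= /mrestr /pushforward /mscale/= YA//.
by rewrite fineK ?fin_num_measure// muleC.
Qed.

Lemma integral_indep (P : probability T R) (A : set T) (Y : T -> R)
    (f : R -> R) :
  measurable A -> measurable_fun setT Y -> measurable_fun setT f ->
  P.-integrable setT (fun w => (f (Y w))%:E) ->
  (forall B, measurable B -> P (Y @^-1` B `&` A) = P (Y @^-1` B) * P A) ->
  \int[P]_(w in A) (f (Y w))%:E = P A * \int[P]_w (f (Y w))%:E.
Proof.
move=> mA mY mf fi YA.
have mEf : measurable_fun setT (EFin \o f) by exact/measurable_EFinP.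
have posE D : \int[P]_(w in D) (fun w => (f (Y w))%:E)^\+ w =
    \int[P]_(w in D) (EFin \o f)^\+ (Y w).
  by apply: eq_integral => w _; rewrite !funeposE.
have negE D : \int[P]_(w in D) (fun w => (f (Y w))%:E)^\- w =
    \int[P]_(w in D) (EFin \o f)^\- (Y w).
  by apply: eq_integral => w _; rewrite !funenegE.
rewrite integralE [X in _ = _ * X]integralE !posE !negE.
rewrite (@ge0_integral_indep _ _ _ ((EFin \o f)^\+) mA mY
  (measurable_funepos mEf))//.
rewrite (@ge0_integral_indep _ _ _ ((EFin \o f)^\-) mA mY
  (measurable_funeneg mEf))//.
rewrite -posE -negE.
rewrite [RHS]muleBr ?fin_num_measure//.
by apply: integrable_add_def.
Qed.
End independent_event.

(** * Series and moments of the Poisson law *)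

Section series.
Local Open Scope ereal_scope.
Context {R : realType}.

(** If the right-hand side is infinite there is nothing to prove; otherwise the
series is the difference of those of its positive and negative parts. *)
Lemma lee_abse_eseries (u : (\bar R)^nat) :
  `| \sum_(n <oo) u n | <= \sum_(n <oo) `|u n|.
Proof.
have [su|nsu] := ltP (\sum_(n <oo) `|u n|) +oo; last first.
  by apply: le_trans nsu; rewrite leey.
rewrite summable_eseries; last by rewrite /summable -nneseries_esum.
apply: le_trans (lee_abs_sub _ _) _.
rewrite !gee0_abs ?nneseries_ge0// -nneseriesD//.
rewrite le_eqVlt; apply/orP; left; apply/eqP; apply: eq_eseriesr => n _.
by rewrite -[RHS]/((abse \o u) n) fune_abse.
Qed.
End series.

Section poisson.
Context {R : realType} (lambda : R).
Hypothesis lambda_gt0 : 0 < lambda.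
Let p := poisson_pmf lambda.

Let p_ge0 n : 0 <= p n. Proof. exact: poisson_pmf_ge0. Qed.

Lemma poisson_pmf_series : (\sum_(n <oo) (p n)%:E = 1)%E.
Proof.
rewrite nneseries_esumT; last by move=> n; rewrite lee_fin; exact: p_ge0.
rewrite -(@probability_setT _ _ _ (poisson_prob lambda 0)).
by rewrite [RHS](_ : _ = poisson_prob lambda 0 setT)// /poisson_prob lambda_gt0.
Qed.

Lemma poisson_pmfS n : p n.+1 * n.+1%:R = lambda * p n.
Proof.
rewrite /p /poisson_pmf lambda_gt0 factS natrM invfM exprS.
have n0 : n.+1%:R != 0 :> R by rewrite pnatr_eq0.
have f0 : n`!%:R != 0 :> R by rewrite pnatr_eq0 -lt0n fact_gt0.
move: n0 f0; move: (n.+1%:R) (n`!%:R) => a b a0 b0.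
by field; rewrite b0.
Qed.

(** The Stein-Chen identity E[N F(N)] = lambda E[F(N + 1)]; it yields the first
two moments of the Poisson law. *)
Lemma poisson_stein_chen (F : nat -> R) : (forall n, 0 <= F n) ->
  (\sum_(n <oo) (p n * (n%:R * F n))%:E =
   lambda%:E * \sum_(n <oo) (p n * F n.+1)%:E)%E.
Proof.
move=> F0; rewrite nneseries_recl//; last first.
  by move=> n _; rewrite lee_fin !mulr_ge0.
rewrite mul0r mulr0 add0e -(nneseries_addn 1); last first.
  by move=> n; rewrite lee_fin !mulr_ge0.
rewrite -nneseriesZl; last by move=> n _; rewrite lee_fin mulr_ge0.
apply: eq_eseriesr => n _; rewrite addn1 -EFinM; congr EFin.
by rewrite mulrA poisson_pmfS mulrA.
Qed.

Lemma poisson_mean : (\sum_(n <oo) (p n * n%:R)%:E = lambda%:E)%E.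
Proof.
have := @poisson_stein_chen (fun=> 1) (fun=> ler01).
under eq_eseriesr do rewrite mulr1.
under [in RHS]eq_eseriesr do rewrite mulr1.
by rewrite poisson_pmf_series mule1.
Qed.

(** The square is expanded after 2 N / lambda, of mean 2, has been added on both
sides, so that only series with nonnegative terms are split. *)
Lemma poisson_variance :
  (\sum_(n <oo) (p n * (n%:R / lambda - 1) ^+ 2)%:E = (lambda^-1)%:E)%E.
Proof.
have l0 : lambda != 0 by rewrite gt_eqF.
have m1 := poisson_mean.
have m2 : (\sum_(n <oo) (p n * (n%:R * n%:R))%:E =
    (lambda * (lambda + 1))%:E)%E.
  rewrite poisson_stein_chen// EFinM; congr (_ * _)%E.
  under eq_eseriesr do rewrite -natr1 mulrDr mulr1 EFinD.
  rewrite nneseriesD; first by rewrite m1 poisson_pmf_series.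
  - by move=> n _ _; rewrite lee_fin mulr_ge0.
  - by move=> n _ _; rewrite lee_fin.
have : (\sum_(n <oo) (p n * (n%:R / lambda - 1) ^+ 2)%:E + 2%:E =
    (lambda^-1)%:E + 2%:E :> \bar R)%E.
  transitivity (\sum_(n <oo) ((p n * (n%:R / lambda - 1) ^+ 2)%:E +
      (2 / lambda)%:E * (p n * n%:R)%:E) : \bar R)%E.
    rewrite nneseriesD; last 2 first.
    - by move=> n _ _; rewrite lee_fin mulr_ge0// sqr_ge0.
    - by move=> n _ _; rewrite lee_fin !mulr_ge0// invr_ge0 ltW.
    rewrite nneseriesZl; last by move=> n _; rewrite lee_fin mulr_ge0.
    by rewrite m1 -EFinM divfK.
  transitivity (\sum_(n <oo) ((lambda ^- 2)%:E * (p n * (n%:R * n%:R))%:E +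
      (p n)%:E) : \bar R)%E.
    apply: eq_eseriesr => n _; rewrite -!EFinM -!EFinD; congr EFin.
    by field.
  rewrite nneseriesD; last 2 first.
  - by move=> n _ _; rewrite lee_fin !mulr_ge0// invr_ge0 sqr_ge0.
  - by move=> n _ _; rewrite lee_fin.
  rewrite nneseriesZl; last by move=> n _; rewrite lee_fin !mulr_ge0.
  rewrite m2 poisson_pmf_series -EFinM -!EFinD; congr EFin.
  by field.
by case: (\sum_(n <oo) _)%E => //= r [] /addIr ->.
Qed.

(** With t = n / lambda - 1 and s = sqrt lambda, the elementary bound
|t| <= (s t^2 + 1 / s) / 2 replaces the Cauchy-Schwarz inequality. *)
Lemma poisson_sqrt_deviation :
  (\sum_(n <oo) (p n * `|Num.sqrt (n%:R / lambda) - 1|)%:E <=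
    ((Num.sqrt lambda)^-1)%:E)%E.
Proof.
set s := Num.sqrt lambda.
have s0 : 0 < s by rewrite sqrtr_gt0.
have ss : s ^+ 2 = lambda by rewrite sqr_sqrtr// ltW.
have bound n : ((p n * `|Num.sqrt (n%:R / lambda) - 1|)%:E <=
    (s / 2)%:E * (p n * (n%:R / lambda - 1) ^+ 2)%:E
     + ((2 * s)^-1)%:E * (p n)%:E)%E.
  rewrite -!EFinM -EFinD lee_fin mulrCA -[X in _ <= _ + X]mulrC -mulrDr.
  apply: ler_wpM2l => //.
  set x := n%:R / lambda; set t := x - 1.
  have x0 : 0 <= x by rewrite divr_ge0// ltW.
  apply: (@le_trans _ _ `|t|).
    have -> : t = (Num.sqrt x - 1) * (Num.sqrt x + 1).
      by rewrite -subr_sqr expr1n sqr_sqrtr.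
    rewrite normrM ler_peMr// ger0_norm ?addr_ge0 ?sqrtr_ge0//.
    by rewrite lerDr sqrtr_ge0.
  rewrite -[t ^+ 2]real_normK ?num_real//; move: `|t| => u.
  rewrite -subr_ge0.
  have -> : s / 2 * u ^+ 2 + (2 * s)^-1 - u = (2 * s)^-1 * (s * u - 1) ^+ 2.
    by field; rewrite gt_eqF.
  by rewrite mulr_ge0 ?sqr_ge0// invr_ge0 mulr_ge0// ltW.
apply: le_trans (lee_nneseries _ _) _.
- by move=> n _ _; rewrite lee_fin mulr_ge0.
- by move=> n _; exact: bound.
rewrite nneseriesD; last 2 first.
- move=> n _ _; rewrite -EFinM lee_fin.
  by apply: mulr_ge0; [rewrite divr_ge0// ltW|rewrite mulr_ge0// sqr_ge0].
- move=> n _ _; rewrite -EFinM lee_fin.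
  by apply: mulr_ge0 => //; rewrite invr_ge0 mulr_ge0// ltW.
rewrite !nneseriesZl; last 2 first.
- by move=> n _; rewrite lee_fin.
- by move=> n _; rewrite lee_fin mulr_ge0 ?sqr_ge0.
rewrite poisson_variance poisson_pmf_series -EFinM mule1 -EFinD lee_fin -ss.
by rewrite le_eqVlt; apply/orP; left; apply/eqP; field; rewrite gt_eqF.
Qed.

End poisson.

(** * Random sums with an independent number of terms *)

Section random_sum.
Local Open Scope ereal_scope.
Context d (T : measurableType d) (R : realType) (P : probability T R).
Variables (X : nat -> {RV P >-> R}) (N : {RV P >-> nat}) (c : R).
Hypothesis indepN : independent_of_seq N X.

Let S n w := (c * \sum_(j < n) X j w)%R.

Let mN n : measurable (N @^-1` [set n]).
Proof. exact: measurable_funPTI. Qed.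

Let mS n : measurable_fun setT (S n).
Proof. by apply: measurable_funM => //; apply: measurable_sum. Qed.

(** The partial sum is measurable for the sigma-algebra generated by X, as a sum
of functions that are; the underlying set is equipped with that structure. *)
Lemma sigma_algebra_seq_partial_sum n (B : set R) : measurable B ->
  sigma_algebra_seq X (S n @^-1` B).
Proof.
move=> mB.
pose G := \bigcup_j preimage_set_system setT (X j) measurable.
have mX j : measurable_fun setT (X j : g_sigma_algebraType G -> R).
  move=> _ A mA; apply: sub_sigma_algebra; exists j => //.
  by exists A.
have mSG : measurable_fun setT (S n : g_sigma_algebraType G -> R).
  by apply: measurable_funM => //; apply: measurable_sum.
by have := mSG measurableT B mB; rewrite setTI.
Qed.

Let indepS n (B : set R) : measurable B ->
  P (S n @^-1` B `&` N @^-1` [set n]) = P (S n @^-1` B) * P (N @^-1` [set n]).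
Proof.
by move=> mB; apply: indepN => //; exact: sigma_algebra_seq_partial_sum.
Qed.

Let bigcupN : \bigcup_n (N @^-1` [set n]) = setT.
Proof. by apply/seteqP; split=> // w _; exists (N w). Qed.

Let trivN : trivIset setT (fun n => N @^-1` [set n]).
Proof. by move=> i j _ _ [w [/= <- <-]]. Qed.

Lemma ge0_expectation_nat (F : nat -> \bar R) : (forall n, 0 <= F n) ->
  \int[P]_w F (N w) = \sum_(n <oo) P (N @^-1` [set n]) * F n.
Proof.
move=> F0; rewrite -bigcupN ge0_integral_bigcup//; last first.
  rewrite bigcupN.
  have mF : measurable_fun setT F by [].
  exact: measurableT_comp.
apply: eq_eseriesr => n _.
rewrite (eq_integral (fun=> F n)); last by move=> w; rewrite inE => /= ->.
by rewrite integral_cst// muleC.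
Qed.

Lemma ge0_integral_random_sum (f : R -> \bar R) :
  measurable_fun setT f -> (forall x, 0 <= f x) ->
  \int[P]_w f (scaled_random_sum c N X w) =
  \sum_(n <oo) P (N @^-1` [set n]) * \int[P]_w f (S n w).
Proof.
move=> mf f0; rewrite -{1}bigcupN ge0_integral_bigcup//; last first.
  rewrite bigcupN; exact: measurableT_comp.
apply: eq_eseriesr => n _.
rewrite -ge0_integral_indep//; last exact: indepS.
by apply: eq_integral => w; rewrite inE /scaled_random_sum => /= ->.
Qed.

(** The law of the random sum is the mixture of the laws of the partial sums;
this is the triangle inequality for that mixture. *)
Lemma abse_integral_random_sum (f : R -> R) : measurable_fun setT f ->
  P.-integrable setT (fun w => (f (scaled_random_sum c N X w))%:E) ->
  (forall n, P.-integrable setT (fun w => (f (S n w))%:E)) ->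
  `| \int[P]_w (f (scaled_random_sum c N X w))%:E | <=
  \sum_(n <oo) P (N @^-1` [set n]) * `| \int[P]_w (f (S n w))%:E |.
Proof.
move=> mf fi fiS.
rewrite -{1}bigcupN integral_bigcup//; last by rewrite bigcupN.
apply: le_trans (lee_abse_eseries _) _.
rewrite le_eqVlt; apply/orP; left; apply/eqP; apply: eq_eseriesr => n _.
rewrite -[X in X * _]gee0_abs// -abseM -integral_indep//; last exact: indepS.
congr abse.
by apply: eq_integral => w; rewrite inE /scaled_random_sum => /= ->.
Qed.

End random_sum.

(** * Moments of partial sums *)

Section moments.
Local Open Scope ereal_scope.
Context d (T : measurableType d) (R : realType) (P : probability T R).
Implicit Type Y : {RV P >-> R}.

Lemma second_moment_ge0 Y : 0 <= second_moment Y.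
Proof. by apply: expectation_ge0 => w; rewrite sqr_ge0. Qed.

Lemma third_abs_moment_ge0 Y : 0 <= third_abs_moment Y.
Proof. by apply: expectation_ge0 => w; rewrite exprn_ge0. Qed.

(** Follows from x^2 <= 1 + |x|^3. *)
Lemma second_moment_fin_num Y : third_abs_moment Y < +oo ->
  second_moment Y \is a fin_num.
Proof.
move=> Y3; rewrite ge0_fin_numE ?second_moment_ge0//.
apply: (@le_lt_trans _ _ (1 + third_abs_moment Y)); last first.
  by rewrite lte_add_pinfty// ltry.
rewrite /second_moment /third_abs_moment !unlock.
have <- : \int[P]_w (cst 1%R w)%:E = 1%:E.
  by have := expectation_cst P 1%R; rewrite unlock.
rewrite -ge0_integralD//=; last first.
  by apply/measurable_EFinP; apply: measurable_funX; exact: measurableT_comp.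
apply: ge0_le_integral => //=.
- by move=> w _; rewrite lee_fin sqr_ge0.
- by apply/measurable_EFinP; apply: measurable_funX.
- apply: emeasurable_funD => //.
  by apply/measurable_EFinP; apply: measurable_funX; exact: measurableT_comp.
move=> w _; rewrite -EFinD lee_fin -real_normK ?num_real//.
have := normr_ge0 (Y w); move: `|Y w|%R => u u0.
by have [u1|u1] := leP u 1%R; nra.
Qed.

Lemma first_abs_moment_le Y : third_abs_moment Y < +oo ->
  \int[P]_w `|Y w|%:E <= (1 + fine (second_moment Y))%:E.
Proof.
move=> Y3; rewrite EFinD fineK ?second_moment_fin_num//.
rewrite /second_moment !unlock.
have <- : \int[P]_w (cst 1%R w)%:E = 1%:E.
  by have := expectation_cst P 1%R; rewrite unlock.
rewrite -ge0_integralD//=; last 2 first.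
- by move=> w _; rewrite lee_fin sqr_ge0.
- by apply/measurable_EFinP; apply: measurable_funX.
apply: ge0_le_integral => //=.
- by apply/measurable_EFinP; exact: measurableT_comp.
- apply: emeasurable_funD => //.
  by apply/measurable_EFinP; apply: measurable_funX.
move=> w _; rewrite -EFinD lee_fin -real_normK ?num_real//.
by move: `|Y w|%R => u; nra.
Qed.

Variable X : nat -> {RV P >-> R}.
Hypothesis thirdX : forall j, third_abs_moment (X j) < +oo.

Lemma avg_second_momentE n :
  (n%:R * avg_second_moment X n = \sum_(j < n) fine (second_moment (X j)))%R.
Proof.
case: n => [|n]; first by rewrite mul0r big_ord0.
by rewrite /avg_second_moment mulVKf// pnatr_eq0.
Qed.

Lemma avg_third_abs_momentE n :
  (n%:R * avg_third_abs_moment X n =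
   \sum_(j < n) fine (third_abs_moment (X j)))%R.
Proof.
case: n => [|n]; first by rewrite mul0r big_ord0.
by rewrite /avg_third_abs_moment mulVKf// pnatr_eq0.
Qed.

(** A crude bound, linear in n when the averaged variances are bounded; it is
used to obtain integrability. *)
Lemma first_abs_moment_sum_le (c : R) n : (0 <= c)%R ->
  \int[P]_w `|c * \sum_(j < n) X j w|%:E <=
  (c * (n%:R * (1 + avg_second_moment X n)))%:E.
Proof.
move=> c0.
apply: (@le_trans _ _ (\int[P]_w (c%:E * \sum_(j < n) `|X j w|%:E))).
  apply: ge0_le_integral => //=.
  - apply/measurable_EFinP; apply: measurableT_comp => //.
    by apply: measurable_funM => //; apply: measurable_sum.
  - apply: emeasurable_funM => //; apply: emeasurable_sum => j.
    by apply/measurable_EFinP; exact: measurableT_comp.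
  - move=> w _; rewrite sumEFin -EFinM lee_fin normrM ger0_norm//.
    by rewrite ler_wpM2l// ler_norm_sum.
rewrite ge0_integralZl//=; last 2 first.
- apply: emeasurable_sum => j.
  by apply/measurable_EFinP; exact: measurableT_comp.
- by move=> w _; apply: sume_ge0.
rewrite ge0_integral_sum//=; last first.
  by move=> j; apply/measurable_EFinP; exact: measurableT_comp.
rewrite EFinM lee_wpmul2l ?lee_fin// mulrDr mulr1 avg_second_momentE.
have -> : (n%:R + \sum_(j < n) fine (second_moment (X j)) =
    \sum_(j < n) (1 + fine (second_moment (X j))))%R.
  by rewrite big_split/= sumr_const card_ord.
by rewrite -sumEFin; apply: lee_sum => j _; exact: first_abs_moment_le.
Qed.

End moments.

(** * Normal approximation of partial sums *)

Section initial_segment.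
Context d (T : measurableType d) (R : realType) (P : probability T R).

(** A finite family of indices below n is also a finite family of naturals; the
events are extended by the full set. *)
Lemma mutually_independent_ord (X : nat -> {RV P >-> R}) n :
  mutually_independent X -> mutually_independent (fun j : 'I_n => X j).
Proof.
move=> indX J A mA.
pose A' k := if insub k is Some i then A i else setT.
have A'E (j : 'I_n) : A' j = A j by rewrite /A' valK.
have mA' k : measurable (A' k) by rewrite /A'; case: insubP.
have := indX [fset val j | j in J]%fset A' mA'.
rewrite big_imfset/=; last by move=> i j _ _; exact: val_inj.
under [in X in _ = X -> _]eq_bigr do rewrite A'E.
move=> <-; congr (P _); apply/seteqP; split => w /= Hw.
- by move=> k /= /imfsetP[j /= jJ ->]; rewrite A'E; exact: Hw.
- move=> j /= jJ; rewrite -A'E; apply: Hw => /=.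
  by apply/imfsetP; exists j.
Qed.

End initial_segment.

Section partial_sum_bound.
Context d (T : measurableType d) (R : realType) (P : probability T R).
Variables (X : nat -> {RV P >-> R}) (C : R).
Hypothesis hC : wasserstein_berry_esseen_constant C.
Hypothesis indepX : mutually_independent X.
Hypothesis meanX : forall j, ('E_P[X j] = 0)%E.
Hypothesis varX : forall j, (0 < second_moment (X j))%E.
Hypothesis thirdX : forall j, (third_abs_moment (X j) < +oo)%E.

Let sigma_hat n := Num.sqrt (avg_second_moment X n).

Lemma avg_second_moment_gt0 n : (0 < n)%N -> 0 < avg_second_moment X n.
Proof.
move=> n0; rewrite /avg_second_moment mulr_gt0 ?invr_gt0 ?ltr0n//.
case: n n0 => // n _; rewrite big_ord_recl ltr_pwDl//.
  rewrite fine_gt0// varX/=.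
  by have /fin_numPlt/andP[] := second_moment_fin_num (thirdX 0%N).
by apply: sumr_ge0 => j _; rewrite fine_ge0// second_moment_ge0.
Qed.

Lemma avg_third_abs_moment_ge0 n : 0 <= avg_third_abs_moment X n.
Proof.
rewrite /avg_third_abs_moment mulr_ge0 ?invr_ge0//.
by apply: sumr_ge0 => j _; rewrite fine_ge0// third_abs_moment_ge0.
Qed.

Lemma integrable_partial_sum (c : R) n : 0 <= c ->
  P.-integrable setT (EFin \o (fun w => c * \sum_(j < n) X j w)).
Proof.
move=> c0; apply/integrableP; split.
  apply/measurable_EFinP; apply: measurable_funM => //.
  exact: measurable_sum.
exact: le_lt_trans (first_abs_moment_sum_le thirdX n c0) (ltry _).
Qed.

(** Here c times the sum is c B times its standardization, where
B = sqrt n * sigma_hat n, so the factor B^-3 of the Berry-Esseen bound becomes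
c B^-2. *)
Lemma berry_esseen_partial_sum (h : R -> R) (c : R) n : 0 < c -> (0 < n)%N ->
  1.-lipschitz h ->
  (`| \int[P]_w (h (c * \sum_(j < n) X j w)%R)%:E
      - \int[normal_law 0 1]_x (h (c * Num.sqrt n%:R * sigma_hat n * x)%R)%:E |
    <= (C * c * (avg_third_abs_moment X n / sigma_hat n ^+ 2))%:E)%E.
Proof.
move=> c0 n0 hl.
pose Y (j : 'I_n) := X j.
have := hC n0 (mutually_independent_ord indepX) (fun j => meanX j)
  (fun j => varX j) (fun j => thirdX j).
rewrite -avg_second_momentE -avg_third_abs_momentE sqrtrM//.
rewrite -/(sigma_hat n).
set B := Num.sqrt n%:R * sigma_hat n => /= hB.
have sh0 : 0 < sigma_hat n by rewrite sqrtr_gt0 avg_second_moment_gt0.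
have sn0 : 0 < Num.sqrt n%:R :> R by rewrite sqrtr_gt0 ltr0n.
have B0 : 0 < B by rewrite mulr_gt0.
have cB0 : 0 < c * B by rewrite mulr_gt0.
have sE w : c * B * normalized_sum Y B w = c * \sum_(j < n) X j w.
  by rewrite /normalized_sum mulrA mulfK ?gt_eqF.
have mid : measurable_fun setT (EFin \o @id R) by exact/measurable_EFinP.
have iS : P.-integrable setT (EFin \o normalized_sum Y B).
  apply: (@integrable_partial_sum B^-1 n).
  by rewrite invr_ge0 ltW.
have iD : (distribution P (normalized_sum Y B)).-integrable setT (EFin \o id).
  apply/integrableP; split => //.
  rewrite (ge0_integral_distribution (normalized_sum Y B))//.
    by have /integrableP[] := iS.
  by apply: measurableT_comp => //.
have mh : measurable_fun setT h.
  by apply: continuous_measurable_fun; exact: lipschitz1_continuous.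
have -> : c * Num.sqrt n%:R * sigma_hat n = c * B by rewrite mulrA.
have -> : (\int[P]_w (h (c * \sum_(j < n) X j w)%R)%:E =
    \int[distribution P (normalized_sum Y B)]_x (h (c * B * x)%R)%:E)%E.
  rewrite (integral_distribution (X := normalized_sum Y B)).
  - by apply: eq_integral => w _ /=; rewrite sE.
  - by apply/measurable_EFinP; apply: measurableT_comp.
  - rewrite (_ : _ \o _ =
        (fun w => (h (c * \sum_(j < n) X j w))%:E)); last first.
      by apply/funext => w /=; rewrite sE.
    apply: (lipschitz1_integrable _ (integrable_partial_sum n (ltW c0)) hl).
    by apply: measurable_funM => //; apply: measurable_sum.
apply: le_trans (le_wasserstein_scale cB0 hl iD integrable_normal_law_id) _.
apply: (@le_trans _ _ ((c * B)%:E *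
    (C * B ^- 3 * (n%:R * avg_third_abs_moment X n))%:E)%E).
  by apply: lee_wpmul2l => //; rewrite lee_fin ltW.
rewrite -EFinM lee_fin le_eqVlt; apply/orP; left; apply/eqP.
have -> : n%:R = Num.sqrt n%:R ^+ 2 :> R by rewrite sqr_sqrtr.
rewrite /B; move: sh0 sn0; move: (sigma_hat n) (Num.sqrt n%:R) => a b a0 b0.
by field; rewrite ?gt_eqF.
Qed.

(** The sign of C is read off the Berry-Esseen bound itself, which dominates a
distance. *)
Lemma berry_esseen_term_ge0 (c : R) n : 0 < c -> (0 < n)%N ->
  0 <= C * c * (avg_third_abs_moment X n / sigma_hat n ^+ 2).
Proof.
move=> c0 n0; rewrite -lee_fin.
have l0 : 1.-lipschitz (cst 0 : R -> R).
  by apply/lipschitz1P => x y /=; rewrite subrr normr0.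
by apply: le_trans (berry_esseen_partial_sum c0 n0 l0); exact: abse_ge0.
Qed.

End partial_sum_bound.

Section scalar_estimates.
Context {R : realType}.

(** The right-hand side equals |a - b| (1 + b / a). *)
Lemma dist_le_mul_ratio (a b : R) : 0 < a -> 0 < b ->
  `|a - b| <= a * `|1 - b ^+ 2 / a ^+ 2|.
Proof.
move=> a0 b0.
have -> : a * `|1 - b ^+ 2 / a ^+ 2| = `|a - b| * (1 + b / a).
  have -> : 1 - b ^+ 2 / a ^+ 2 = (a - b) * (1 + b / a) / a.
    by field; rewrite gt_eqF.
  rewrite !normrM normfV (gtr0_norm a0) mulrC divfK ?gt_eqF//.
  by rewrite (@ger0_norm _ (1 + _))// addr_ge0// divr_ge0// ltW.
by rewrite ler_peMr// lerDl divr_ge0// ltW.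
Qed.

Lemma dist_le_min (a b : R) : 0 < a -> 0 < b ->
  `|a - b| <= Num.min (a * `|1 - b ^+ 2 / a ^+ 2|) (b * `|1 - a ^+ 2 / b ^+ 2|).
Proof.
by move=> a0 b0; rewrite le_min dist_le_mul_ratio// distrC dist_le_mul_ratio.
Qed.

Lemma sqrt2pi_le2 : Num.sqrt (2 / pi) <= 2 :> R.
Proof.
rewrite -[X in _ <= X](ger0_norm (ler0n R 2)) -sqrtr_sqr.
have p2 := @pi_ge2 R.
rewrite ler_wsqrtr// ler_pdivrMr ?pi_gt0//; lra.
Qed.

End scalar_estimates.

(** * Poisson random sums *)

Section poisson_sum.
Context d (T : measurableType d) (R : realType) (P : probability T R).
Variables (X : nat -> {RV P >-> R}) (N : {RV P >-> nat}) (lambda sigma : R).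
Hypothesis thirdX : forall j, (third_abs_moment (X j) < +oo)%E.
Hypothesis lambda_gt0 : 0 < lambda.
Hypothesis poissonN : forall n, P (N @^-1` [set n]) = (poisson_pmf lambda n)%:E.
Hypothesis indepN : independent_of_seq N X.
Hypothesis sigma_lim : avg_second_moment X n @[n --> \oo] --> sigma ^+ 2.

(** A bound M of the convergent averaged variances gives
E|W| <= c (1 + M) E N. *)
Lemma integrable_poisson_sum (c : R) : 0 <= c ->
  P.-integrable setT (EFin \o scaled_random_sum c N X).
Proof.
move=> c0; apply/integrableP; split; first exact/measurable_EFinP.
have [M hM] : exists M, forall n, avg_second_moment X n <= M.
  have /cvg_seq_bounded [M [_ hM]] : cvgn (avg_second_moment X).
    by apply/cvg_ex; exists (sigma ^+ 2).
  exists (M + 1) => n; apply: le_trans (ler_norm _) _.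
  by apply: hM => //; rewrite ltrDl.
have M1 : 0 <= 1 + M.
  rewrite addr_ge0// (le_trans _ (hM 0%N))// /avg_second_moment.
  by rewrite invr0 mul0r.
rewrite (@ge0_integral_random_sum _ _ _ _ _ _ c indepN
  (fun x => `|x|%:E))//; last first.
  exact/measurable_EFinP.
apply: (@le_lt_trans _ _ (c * (1 + M) * lambda)%:E); last exact: ltry.
rewrite EFinM -(poisson_mean lambda_gt0) -nneseriesZl; last first.
  by move=> n _; rewrite lee_fin mulr_ge0// poisson_pmf_ge0.
apply: lee_nneseries => [n _ _|n _].
  by apply: mule_ge0 => //; apply: integral_ge0.
rewrite poissonN.
apply: (@le_trans _ _ ((poisson_pmf lambda n)%:E *
    (c * (n%:R * (1 + avg_second_moment X n)))%:E)%E).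
  apply: lee_wpmul2l; first by rewrite lee_fin poisson_pmf_ge0.
  exact: first_abs_moment_sum_le.
rewrite -!EFinM lee_fin.
rewrite [leRHS]mulrCA; apply: ler_wpM2l; first exact: poisson_pmf_ge0.
rewrite -mulrA; apply: ler_wpM2l => //.
by rewrite mulrC; apply: ler_wpM2r => //; rewrite lerD2l.
Qed.
End poisson_sum.

Section conditional_bound.
Context d (T : measurableType d) (R : realType) (P : probability T R).
Variables (X : nat -> {RV P >-> R}) (C lambda sigma : R).
Hypothesis hC : wasserstein_berry_esseen_constant C.
Hypothesis indepX : mutually_independent X.
Hypothesis meanX : forall j, ('E_P[X j] = 0)%E.
Hypothesis varX : forall j, (0 < second_moment (X j))%E.
Hypothesis thirdX : forall j, (third_abs_moment (X j) < +oo)%E.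
Hypothesis lambda_gt0 : 0 < lambda.
Hypothesis sigma_gt0 : 0 < sigma.

Let sigma_hat n := Num.sqrt (avg_second_moment X n).

(** The comparison goes through t Z with t = sqrt (n / lambda) * sigma_hat n, a
normal variable with the same variance as the scaled partial sum. *)
Lemma conditional_wasserstein_bound (h : R -> R) n : 1.-lipschitz h ->
  (`| \int[P]_w (h ((Num.sqrt lambda)^-1 * \sum_(j < n) X j w)%R)%:E
      - \int[normal_law 0 sigma]_x (h x)%:E | <=
   (sigma * Num.sqrt (2 / pi) * `|Num.sqrt (n%:R / lambda) - 1|
    + C / Num.sqrt lambda *
      (if n == 0%N then 0 else avg_third_abs_moment X n / sigma_hat n ^+ 2)
    + 2 / Num.sqrt lambda *
      (Num.sqrt n%:R *
       Num.min (sigma_hat n * `|1 - sigma ^+ 2 / sigma_hat n ^+ 2|)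
               (sigma * `|1 - sigma_hat n ^+ 2 / sigma ^+ 2|)))%:E)%E.
Proof.
move=> hl.
have ch := lipschitz1_continuous hl.
rewrite (integral_normal_law_scale sigma_gt0 ch).
case: n => [|n].
  (* The empty sum has the law of 0 * Z. *)
  rewrite eqxx mulr0 addr0 mul0r sqrtr0 mul0r mulr0 addr0 sub0r normrN1 mulr1.
  under eq_integral do rewrite big_ord0 mulr0.
  have -> : (\int[P]_w (h 0)%:E = \int[normal_law 0 1]_x (h (0 * x)%R)%:E)%E.
    under [RHS]eq_integral do rewrite mul0r.
    have := expectation_cst P (h 0).
    by have := expectation_cst (normal_law 0 1) (h 0); rewrite unlock /= => -> ->.
  apply: le_trans (normal_law_dilation_dist 0 sigma hl) _.
  by rewrite sub0r normrN gtr0_norm.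
set c := (Num.sqrt lambda)^-1.
have sl0 : 0 < Num.sqrt lambda by rewrite sqrtr_gt0.
have c0 : 0 < c by rewrite invr_gt0.
have sh0 : 0 < sigma_hat n.+1.
  by rewrite sqrtr_gt0 avg_second_moment_gt0.
have scE : Num.sqrt (n.+1%:R / lambda) = c * Num.sqrt n.+1%:R.
  by rewrite sqrtrM// sqrtrV ?ltW// mulrC.
rewrite scE /=; set s := Num.sqrt n.+1%:R.
have s0 : 0 <= s by rewrite sqrtr_ge0.
set a := (\int[P]_w _)%E; set b := (\int[normal_law 0 1]_x _)%E.
pose m := (\int[normal_law 0 1]_x (h (c * s * sigma_hat n.+1 * x)%R)%:E)%E.
have fm : m \is a fin_num.
  apply: integrable_fin_num => //.
  apply: (@lipschitz1_integrable _ _ _ (normal_law 0 1) (fun x => _ * x)) hl.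
    exact: measurable_funM.
  exact: (integrableZl measurableT _ integrable_normal_law_id).
have -> : (a - b = (a - m) + (m - b))%E by rewrite addeA subeK.
apply: le_trans (lee_abs_add _ _) _.
apply: le_trans (leeD
  (berry_esseen_partial_sum hC indepX meanX varX thirdX c0 (ltn0Sn n) hl)
  (normal_law_dilation_dist _ _ hl)) _.
rewrite -EFinD lee_fin -/(sigma_hat n.+1).
rewrite -/c [leRHS]addrAC [leRHS]addrC lerD2l.
have dE : `|c * s * sigma_hat n.+1 - sigma| <=
    c * s * `|sigma_hat n.+1 - sigma| + sigma * `|c * s - 1|.
  have -> : c * s * sigma_hat n.+1 - sigma =
     c * s * (sigma_hat n.+1 - sigma) + sigma * (c * s - 1) by ring.
  apply: le_trans (ler_normD _ _) _.
  rewrite !normrM (ger0_norm (ltW c0)) (ger0_norm s0).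
  by rewrite (ger0_norm (ltW sigma_gt0)).
apply: le_trans (ler_wpM2r (sqrtr_ge0 _) dE) _.
rewrite mulrDl addrC lerD//; last by rewrite [leLHS]mulrAC lexx.
have := dist_le_min sh0 sigma_gt0; set mn := Num.min _ _ => dmin.
rewrite -!mulrA [leRHS]mulrCA; apply: ler_wpM2l; first exact: ltW.
rewrite [leRHS]mulrCA; apply: ler_wpM2l => //.
rewrite [leLHS]mulrC; apply: ler_pM => //; first exact: sqrt2pi_le2.
Qed.

End conditional_bound.

Theorem theorem3p8 (R : realType) (C_W : R)
    (hC : wasserstein_berry_esseen_constant C_W)
    (d : measure_display) (T : measurableType d) (P : probability T R)
    (X : nat -> {RV P >-> R}) (N : {RV P >-> nat}) (lambda sigma : R)
    (indepX : mutually_independent X)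
    (meanX : forall j, ('E_P[X j] = 0)%E)
    (varX : forall j, (0 < second_moment (X j))%E)
    (thirdX : forall j, (third_abs_moment (X j) < +oo)%E)
    (lambda_gt0 : 0 < lambda)
    (poissonN : forall n, P (N @^-1` [set n]) = (poisson_pmf lambda n)%:E)
    (indepN : independent_of_seq N X)
    (sigma_gt0 : 0 < sigma)
    (sigma_lim : avg_second_moment X n @[n --> \oo] --> sigma ^+ 2) :
  let sigma_hat n := Num.sqrt (avg_second_moment X n) in
  let W := scaled_random_sum (Num.sqrt lambda)^-1 N X in
  (wasserstein (distribution P W) (normal_law 0 sigma) <=
    (sigma * Num.sqrt (2 / pi) * (Num.sqrt lambda)^-1)%:E
    + (C_W / Num.sqrt lambda)%:E
      * 'E_P[(fun w => if N w == 0%N then 0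
                       else avg_third_abs_moment X (N w) / sigma_hat (N w) ^+ 2)%R]
    + (2 * expR (- lambda) / Num.sqrt lambda)%:E
      * \sum_(1 <= n <oo)
          (lambda ^+ n / (Num.sqrt n%:R * n.-1`!%:R)
           * Num.min (sigma_hat n * `|1 - sigma ^+ 2 / sigma_hat n ^+ 2|)
                     (sigma * `|1 - sigma_hat n ^+ 2 / sigma ^+ 2|))%:E)%E.
Proof.
pose sigma_hat n := Num.sqrt (avg_second_moment X n).
pose W := scaled_random_sum (Num.sqrt lambda)^-1 N X.
cbv zeta.
have sl0 : 0 < Num.sqrt lambda by rewrite sqrtr_gt0.
have c0 : 0 < (Num.sqrt lambda)^-1 by rewrite invr_gt0.
pose p := poisson_pmf lambda.
have p0 n : 0 <= p n by exact: poisson_pmf_ge0.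
pose A n : R := `|Num.sqrt (n%:R / lambda) - 1|.
pose r n := if n == 0%N then 0 else avg_third_abs_moment X n / sigma_hat n ^+ 2.
pose m n := Num.min (sigma_hat n * `|1 - sigma ^+ 2 / sigma_hat n ^+ 2|)
                    (sigma * `|1 - sigma_hat n ^+ 2 / sigma ^+ 2|).
have r0 n : 0 <= r n.
  rewrite /r; case: eqP => // _.
  by rewrite divr_ge0 ?sqr_ge0 ?avg_third_abs_moment_ge0.
have Cr0 n : 0 <= C_W / Num.sqrt lambda * r n.
  rewrite /r; case: eqP => [_|/eqP]; first by rewrite mulr0.
  by rewrite -lt0n; exact: berry_esseen_term_ge0.
have m0 n : 0 <= m n.
  by rewrite /m le_min !mulr_ge0 ?normr_ge0 ?sqrtr_ge0 ?(ltW sigma_gt0).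
apply: ge_ereal_sup => _ [h hl <-].
have ch := lipschitz1_continuous hl.
have mh : measurable_fun setT h by exact: continuous_measurable_fun.
have iW : P.-integrable setT (fun w => (h (W w))%:E).
  apply: (lipschitz1_integrable _ _ hl) => //.
  exact: (integrable_poisson_sum thirdX lambda_gt0 poissonN indepN sigma_lim
    (ltW c0)).
rewrite integral_distribution//; last exact/measurable_EFinP.
have fb : (\int[normal_law 0 sigma]_x (h x)%:E)%E \is a fin_num.
  rewrite (integral_normal_law_scale sigma_gt0 ch).
  apply: integrable_fin_num => //.
  apply: (@lipschitz1_integrable _ _ _ (normal_law 0 1) (fun x => _ * x)) hl.
    exact: measurable_funM.
  exact: (integrableZl measurableT _ integrable_normal_law_id).
have bnd n := conditional_wasserstein_bound (sigma := sigma) hC indepX meanX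
  varX thirdX lambda_gt0 sigma_gt0 n hl.
move: fb bnd; set b := (\int[normal_law 0 sigma]_x (h x)%:E)%E => fb bnd.
(* Centering h makes the error at n an integral over the n-th law alone, so the
   triangle inequality applies without splitting E h(sigma Z) over n. *)
pose f x := h x - fine b.
have mf : measurable_fun setT f by exact: measurable_funB.
have icst : P.-integrable setT (EFin \o cst (fine b)).
  exact: finite_measure_integrable_cst.
have intf (Y : T -> R) : P.-integrable setT (fun w => (h (Y w))%:E) ->
    (\int[P]_w (f (Y w))%:E = \int[P]_w (h (Y w))%:E - b)%E.
  move=> iY; rewrite (integralB_EFin measurableT iY icst).
  congr (_ - _)%E; rewrite -[RHS](fineK fb).
  by have := expectation_cst P (fine b); rewrite unlock.
have iS n : P.-integrable setT
    (fun w => (h ((Num.sqrt lambda)^-1 * \sum_(j < n) X j w))%:E).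
  apply: (lipschitz1_integrable _ (integrable_partial_sum thirdX n (ltW c0)) hl).
  by apply: measurable_funM => //; apply: measurable_sum.
rewrite -[X in (X - b)%E]/(\int[P]_w (h (W w))%:E)%E -intf//.
apply: le_trans (abse_integral_random_sum indepN mf _ _) _.
- exact: (integrableB measurableT iW icst).
- by move=> n; exact: (integrableB measurableT (iS n) icst).
apply: le_trans (lee_nneseries _ _) _.
- by move=> n _ _; exact: mule_ge0.
- move=> n _; rewrite intf// poissonN.
  apply: lee_wpmul2l; first by rewrite lee_fin.
  exact: bnd.
(* The averaged bound splits into three series, one for each summand. *)
pose kA := sigma * Num.sqrt (2 / pi).
have kA0 : 0 <= kA by rewrite mulr_ge0 ?sqrtr_ge0// ltW.
pose kr := C_W / Num.sqrt lambda.
pose q n := p n * (2 / Num.sqrt lambda * (Num.sqrt n%:R * m n)).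
have q0 n : 0 <= q n.
  by rewrite !mulr_ge0 ?sqrtr_ge0// invr_ge0 ltW.
rewrite (eq_eseriesr (g := fun n => (kA%:E * (p n * A n)%:E
    + kr%:E * (p n * r n)%:E + (q n)%:E)%E)); last first.
  move=> n _; rewrite -!EFinM -!EFinD; congr EFin.
  by rewrite /q !mulrDr (mulrCA kA) (mulrCA kr).
have pr0 n : 0 <= kr * (p n * r n) by rewrite mulrCA mulr_ge0// Cr0.
have pA0 n : 0 <= p n * A n by apply: mulr_ge0 => //; exact: normr_ge0.
rewrite nneseriesD; last 2 first.
- by move=> n _ _; rewrite -!EFinM -EFinD lee_fin addr_ge0// mulr_ge0.
- by move=> n _ _; rewrite lee_fin.
rewrite nneseriesD; last 2 first.
- by move=> n _ _; rewrite -EFinM lee_fin mulr_ge0.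
- by move=> n _ _; rewrite -EFinM lee_fin.
rewrite !nneseriesZl; last 2 first.
- by move=> n _; rewrite lee_fin mulr_ge0.
- by move=> n _; rewrite lee_fin.
apply: leeD; first apply: leeD.
- rewrite [leRHS]EFinM; apply: lee_wpmul2l; first by rewrite lee_fin.
  exact: poisson_sqrt_deviation.
- rewrite [X in (_ <= _ * X)%E](_ : _ =
      (\sum_(n <oo) P (N @^-1` [set n]) * (r n)%:E)%E); last first.
    rewrite unlock; apply: (ge0_expectation_nat N (F := fun n => (r n)%:E)) => n.
    by rewrite lee_fin.
  by under [in leRHS]eq_eseriesr do rewrite poissonN.
- have qE0 : (q 0%N)%:E = 0%E by rewrite /q sqrtr0 mul0r !mulr0.
  rewrite nneseries_recl//=; last by move=> n _; rewrite lee_fin.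
  rewrite qE0 add0e.
  have t0 n : (0 <= (lambda ^+ n / (Num.sqrt n%:R * n.-1`!%:R) * m n)%:E)%E.
    rewrite lee_fin; apply: mulr_ge0 => //; apply: divr_ge0.
      by rewrite exprn_ge0// ltW.
    by rewrite mulr_ge0 ?sqrtr_ge0.
  rewrite -nneseriesZl//.
  rewrite -(nneseries_addn (f := fun n => (q n)%:E) 1)//.
  rewrite -(nneseries_addn 1); last first.
    move=> n; apply: mule_ge0; last exact: t0.
    by rewrite lee_fin !mulr_ge0 ?expR_ge0// invr_ge0 ltW.
  rewrite le_eqVlt; apply/orP; left; apply/eqP; apply: eq_eseriesr => n _.
  rewrite addn1 -EFinM; congr EFin.
  rewrite /q /p /poisson_pmf lambda_gt0 factS natrM -/(m n.+1) /=.
  have n1 : 0 < Num.sqrt n.+1%:R :> R by rewrite sqrtr_gt0 ltr0n.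
  have f0 : 0 < n`!%:R :> R by rewrite ltr0n fact_gt0.
  (* With n + 1 written as a square, the identity of the weights is rational in
     its atoms. *)
  have -> : n.+1%:R = Num.sqrt n.+1%:R ^+ 2 :> R by rewrite sqr_sqrtr.
  rewrite sqrtr_sqr (gtr0_norm n1).
  move: n1 f0 sl0; move: (Num.sqrt n.+1%:R) (n`!%:R) (Num.sqrt lambda) (m n.+1).
  move=> a e l mn a0 e0 l0.
  by field; rewrite !gt_eqF.
Qed.
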